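(* If $q^4\neq 1$, then the $\mathbb K$-algebra $\mathcal A$ is generated by $x^2,y^2,z^2$.
   Context: $\mathbb K$ is a field and $q$ is a nonzero scalar in $\mathbb K$ with $q^2\neq 1$. $\mathbb N=\{0,1,2,\ldots\}$. $U_q(\mathfrak{sl}_2)$ is the unital associative $\mathbb K$-algebra with generators $x,y,y^{-1},z$ and relations $yy^{-1}=y^{-1}y=1$, $\frac{qxy-q^{-1}yx}{q-q^{-1}}=1$, $\frac{qyz-q^{-1}zy}{q-q^{-1}}=1$, $\frac{qzx-q^{-1}xz}{q-q^{-1}}=1$. $\mathcal A$ is the $\mathbb K$-subspace of $U_q(\mathfrak{sl}_2)$ spanned by $x^ry^sz^t$ with $r,s,t\in\mathbb N$ and $r+s+t$ even; it is a (unital) $\mathbb K$-subalgebra. Generation is as a unital $\mathbb K$-algebra. *)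

(* Defs.v *)
From HB Require Import structures.
From mathcomp Require Import all_boot all_order all_algebra.
From mathcomp Require Import boolp classical_sets.
From mathcomp Require finmap.
From mathcomp.multinomials Require Import monalg.

Set Implicit Arguments.
Unset Strict Implicit.
Unset Printing Implicit Defensive.

Import GRing.Theory.

Local Open Scope classical_set_scope.
Local Open Scope quotient_scope.
Local Open Scope ring_scope.

Inductive Ugen : Set := genX | genY | genYinv | genZ.

HB.instance Definition _ := gen_eqMixin Ugen.
HB.instance Definition _ := gen_choiceMixin Ugen.

(* The free unital associative K-algebra on x, y, y^-1, z: the monoid algebra
   of the free monoid on the four generators. *)
Notation Ufree K := {malg K[{fmonom Ugen}]}.

(* Locked, as is [Upi] below, only to keep unification from computing in the
   free algebra. *)
HB.lock Definition freegen (K : fieldType) (i : Ugen) : Ufree K := << fmu i >>.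

Section Presentation.
Variables (K : fieldType) (q : K).

Local Notation F := (Ufree K).
Local Notation X := (freegen K genX).
Local Notation Y := (freegen K genY).
Local Notation Y' := (freegen K genYinv).
Local Notation Z := (freegen K genZ).

(* The left-hand side (q a b - q^-1 b a) / (q - q^-1) of the relations. *)
Definition qcomm (A : lalgType K) (a b : A) : A :=
  (q - q^-1)^-1 *: (q *: (a * b) - q^-1 *: (b * a)).

Definition Urelator : set F :=
  [set Y * Y' - 1; Y' * Y - 1;
       qcomm X Y - 1; qcomm Y Z - 1; qcomm Z X - 1].

(* The two-sided ideal of the free algebra generated by the relators. It is
   closed under opposites since - u = (- 1) * u. *)
Inductive Uideal : F -> Prop :=
| Uideal_gen u : Urelator u -> Uideal u
| Uideal0 : Uideal 0
| UidealD u v : Uideal u -> Uideal v -> Uideal (u + v)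
| UidealMl a u : Uideal u -> Uideal (a * u)
| UidealMr a u : Uideal u -> Uideal (u * a).

Lemma UidealN u : Uideal u -> Uideal (- u).
Proof. by move=> Iu; rewrite -mulN1r; apply: UidealMl. Qed.

Lemma UidealZ c u : Uideal u -> Uideal (c *: u).
Proof. by move=> Iu; rewrite -[u]mul1r scalerAl; apply: UidealMl. Qed.

Lemma UidealBC u v : Uideal (u - v) -> Uideal (v - u).
Proof. by move=> /UidealN; rewrite opprB. Qed.

Definition Uequiv (u v : F) : bool := `[< Uideal (u - v) >].

Lemma Uequiv_is_equiv : equiv_class_of Uequiv.
Proof.
split=> [u|u v|v u w].
- by apply/asboolP; rewrite subrr; apply: Uideal0.
- by apply/asboolP/asboolP; apply: UidealBC.
- move=> /asboolP uv /asboolP vw; apply/asboolP.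
  by rewrite -(subrKA v); apply: UidealD.
Qed.

Canonical Uequiv_equiv := EquivRelPack Uequiv_is_equiv.
Canonical Uequiv_encModRel := defaultEncModRel Uequiv.

(* [Uquot] is the quotient set; the algebra [Uq_sl2] below is [Uquot] with the
   hypotheses on [q] that make it nonzero, as required by [algType]. *)
Definition Uquot := {eq_quot Uequiv}.

HB.instance Definition _ : EqQuotient F Uequiv Uquot := EqQuotient.on Uquot.
HB.instance Definition _ := Choice.on Uquot.

Lemma UquotP u v : Uideal (u - v) <-> \pi_Uquot u = \pi_Uquot v.
Proof.
split=> [I|/eqP]; first by apply/eqP; rewrite piE; apply/asboolP.
by rewrite piE => /asboolP.
Qed.

Lemma Uideal_repr u : Uideal (u - repr (\pi_Uquot u)).
Proof. by apply/UquotP; rewrite reprK. Qed.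

Definition Uzero : Uquot := lift_cst Uquot 0.
Definition Uone : Uquot := lift_cst Uquot 1.
Definition Uadd := lift_op2 Uquot +%R.
Definition Uopp := lift_op1 Uquot -%R.
Definition Umul := lift_op2 Uquot *%R.
Definition Uscale (c : K) := lift_op1 Uquot ( *:%R c).

Canonical pi_Uzero_morph := PiConst Uzero.
Canonical pi_Uone_morph := PiConst Uone.

Lemma pi_Uopp : {morph \pi_Uquot : u / - u >-> Uopp u}.
Proof.
move=> u; unlock Uopp; apply/UquotP.
by rewrite -opprD; apply/UidealN/Uideal_repr.
Qed.
Canonical pi_Uopp_morph := PiMorph1 pi_Uopp.

Lemma pi_Uadd : {morph \pi_Uquot : u v / u + v >-> Uadd u v}.
Proof.
move=> u v; unlock Uadd; apply/UquotP.
by rewrite opprD addrACA; apply: UidealD; apply: Uideal_repr.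
Qed.
Canonical pi_Uadd_morph := PiMorph2 pi_Uadd.

Lemma pi_Umul : {morph \pi_Uquot : u v / u * v >-> Umul u v}.
Proof.
move=> u v; unlock Umul; apply/UquotP.
have := Uideal_repr u; have := Uideal_repr v.
move: (repr (\pi_Uquot u)) (repr (\pi_Uquot v)) => u' v' Iv Iu.
have -> : u * v - u' * v' = u * (v - v') + (u - u') * v'.
  by rewrite mulrBr mulrBl addrA subrK.
by apply: UidealD; [apply: UidealMl | apply: UidealMr].
Qed.
Canonical pi_Umul_morph := PiMorph2 pi_Umul.

Lemma pi_Uscale c : {morph \pi_Uquot : u / c *: u >-> Uscale c u}.
Proof.
move=> u; unlock Uscale; apply/UquotP.
by rewrite -scalerBr; apply/UidealZ/Uideal_repr.
Qed.
Canonical pi_Uscale_morph c := PiMorph1 (pi_Uscale c).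

Lemma UaddA : associative Uadd.
Proof. by move=> u v w; rewrite -[u]reprK -[v]reprK -[w]reprK !piE addrA. Qed.

Lemma UaddC : commutative Uadd.
Proof. by move=> u v; rewrite -[u]reprK -[v]reprK !piE addrC. Qed.

Lemma Uadd0 : left_id Uzero Uadd.
Proof. by move=> u; rewrite -[u]reprK !piE add0r. Qed.

Lemma UaddN : left_inverse Uzero Uopp Uadd.
Proof. by move=> u; rewrite -[u]reprK !piE addNr. Qed.

HB.instance Definition _ := GRing.isZmodule.Build Uquot UaddA UaddC Uadd0 UaddN.

Lemma pi_UquotD u v : \pi_Uquot (u + v) = \pi_Uquot u + \pi_Uquot v.
Proof. exact: pi_Uadd. Qed.

Lemma UmulA : associative Umul.
Proof. by move=> u v w; rewrite -[u]reprK -[v]reprK -[w]reprK !piE mulrA. Qed.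

Lemma Umul1 : left_id Uone Umul.
Proof. by move=> u; rewrite -[u]reprK !piE mul1r. Qed.

Lemma Umulr1 : right_id Uone Umul.
Proof. by move=> u; rewrite -[u]reprK !piE mulr1. Qed.

Lemma UmulDl : left_distributive Umul +%R.
Proof.
move=> u v w; rewrite -[u]reprK -[v]reprK -[w]reprK.
by rewrite -pi_UquotD -!pi_Umul -pi_UquotD mulrDl.
Qed.

Lemma UmulDr : right_distributive Umul +%R.
Proof.
move=> u v w; rewrite -[u]reprK -[v]reprK -[w]reprK.
by rewrite -pi_UquotD -!pi_Umul -pi_UquotD mulrDr.
Qed.

HB.instance Definition _ :=
  GRing.Zmodule_isPzRing.Build Uquot UmulA Umul1 Umulr1 UmulDl UmulDr.

Lemma UscaleA a b u : Uscale a (Uscale b u) = Uscale (a * b) u.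
Proof. by rewrite -[u]reprK !piE scalerA. Qed.

Lemma Uscale1 : left_id 1 Uscale.
Proof. by move=> u; rewrite -[u]reprK !piE scale1r. Qed.

Lemma UscaleDr : right_distributive Uscale +%R.
Proof.
move=> c u v; rewrite -[u]reprK -[v]reprK.
by rewrite -pi_UquotD -!pi_Uscale -pi_UquotD scalerDr.
Qed.

Lemma UscaleDl u : {morph Uscale^~ u : a b / a + b}.
Proof. by move=> a b; rewrite -[u]reprK -!pi_Uscale -pi_UquotD scalerDl. Qed.

HB.instance Definition _ :=
  GRing.Zmodule_isLmodule.Build K Uquot UscaleA Uscale1 UscaleDr UscaleDl.

Lemma UscaleAl (c : K) (u v : Uquot) : c *: (u * v) = (c *: u) * v.
Proof.
rewrite -[u]reprK -[v]reprK.
have mulE a b : \pi_Uquot a * \pi_Uquot b = \pi_Uquot (a * b).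
  by rewrite pi_Umul.
have scaleE a : c *: \pi_Uquot a = \pi_Uquot (c *: a) by rewrite pi_Uscale.
by rewrite mulE !scaleE mulE scalerAl.
Qed.

Lemma Ufree_scalerAr (c : K) (u v : F) : c *: (u * v) = u * (c *: v).
Proof.
rewrite [in RHS](malgMEw (finmap.fsubset_refl _) (msuppZ_le c v)) malgME.
rewrite scaler_sumr; apply: eq_bigr => k1 _.
rewrite scaler_sumr; apply: eq_bigr => k2 _.
rewrite mcoeffZ mulrCA; move: (_ * _) => a; apply/malgP => k.
apply: etrans (mcoeffZ _ _ _) _; apply: etrans _ (esym (mcoeffU _ _ _)).
by apply: etrans (congr1 ( *%R c) (mcoeffU _ _ _)) _; rewrite mulrnAr.
Qed.

Lemma UscaleAr (c : K) (u v : Uquot) : c *: (u * v) = u * (c *: v).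
Proof.
rewrite -[u]reprK -[v]reprK.
have mulE a b : \pi_Uquot a * \pi_Uquot b = \pi_Uquot (a * b).
  by rewrite pi_Umul.
have scaleE a : c *: \pi_Uquot a = \pi_Uquot (c *: a) by rewrite pi_Uscale.
by rewrite mulE !scaleE mulE Ufree_scalerAr.
Qed.

Section Nontrivial.
Hypotheses (q_neq0 : q != 0) (q2_neq1 : q ^+ 2 != 1).

Lemma qsubV_neq0 : q - q^-1 != 0.
Proof.
apply: contra q2_neq1; rewrite subr_eq0 => /eqP qE.
by rewrite expr2 {2}qE divff.
Qed.

(* The counit, which sends every generator to 1, shows that the quotient is
   not the zero ring. *)
Definition Uone_mor (m : {fmonom Ugen}) : K := 1.

Lemma Uone_mor_is_mmorphism : mmorphism Uone_mor.
Proof. by split=> // u v; rewrite /Uone_mor mulr1. Qed.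

HB.instance Definition _ :=
  isMultiplicative.Build _ K Uone_mor Uone_mor_is_mmorphism.

Definition Ucounit : F -> K := mmap idfun Uone_mor.

Lemma Ucounit_gen i : Ucounit (freegen K i) = 1.
Proof. by rewrite /Ucounit freegen.unlock mmapU mulr1. Qed.

Lemma Ucounit_ideal u : Uideal u -> Ucounit u = 0.
Proof.
have cD a b : Ucounit (a + b) = Ucounit a + Ucounit b by exact: rmorphD.
have cN a : Ucounit (- a) = - Ucounit a by exact: rmorphN.
have cM a b : Ucounit (a * b) = Ucounit a * Ucounit b by exact: rmorphM.
have c1 : Ucounit 1 = 1 by exact: rmorph1.
have cZ c a : Ucounit (c *: a) = c * Ucounit a by exact: mmapZ.
have c0 : Ucounit 0 = 0 by exact: rmorph0.
move: Ucounit Ucounit_gen cD cN cM c1 cZ c0 => e eG eD eN eM e1 eZ e0.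
have eq i j : e (qcomm (freegen K i) (freegen K j)) = 1.
  have eq2 c1 c2 c3 a b :
      e (c1 *: (c2 *: a - c3 *: b)) = c1 * (c2 * e a - c3 * e b).
    apply: etrans (eZ _ _) _; congr (_ * _); apply: etrans (eD _ _) _.
    by congr (_ + _); [exact: eZ | apply: etrans (eN _) _; rewrite eZ].
  apply: etrans (eq2 _ _ _ _ _) _.
  have eMG i' j' : e (freegen K i' * freegen K j') = 1.
    by apply: etrans (eM _ _) _; rewrite 2!eG mulr1.
  apply: etrans (mulVf qsubV_neq0); congr (_ * _).
  by congr (_ - _); rewrite -[RHS]mulr1; congr (_ * _); exact: eMG.
have eR v : Urelator v -> e v = 0.
  case=> [[[[|]|]|]|] ->; rewrite eD eN e1; apply/eqP; rewrite subr_eq0.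
  1,2: by rewrite eM 2!eG mulr1.
  1-3: by rewrite eq.
elim=> {u}[u /eR //||u v _ u0 _ v0|a u _ u0|a u _ u0].
- exact: e0.
- by rewrite eD u0 v0 addr0.
- by rewrite eM u0 mulr0.
- by rewrite eM u0 mul0r.
Qed.

Lemma Uone_neq0 : (1 : Uquot) != 0.
Proof.
apply/eqP; rewrite -[1]/Uone -[0]/Uzero !piE => /eqP.
rewrite piE => /asboolP; rewrite subr0 => /Ucounit_ideal.
by move/eqP; rewrite /Ucounit rmorph1 oner_eq0.
Qed.

End Nontrivial.

Definition Uq_sl2 of q != 0 & q ^+ 2 != 1 : Type := Uquot.

Section UqAlgebra.
Hypotheses (q_neq0 : q != 0) (q2_neq1 : q ^+ 2 != 1).
Local Notation U := (Uq_sl2 q_neq0 q2_neq1).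

HB.instance Definition _ := GRing.Lmodule.copy U Uquot.
HB.instance Definition _ := GRing.PzRing.copy U Uquot.
HB.instance Definition _ :=
  GRing.PzSemiRing_isNonZero.Build U (Uone_neq0 q_neq0 q2_neq1).
HB.instance Definition _ := GRing.Lmodule_isLalgebra.Build K U UscaleAl.
HB.instance Definition _ := GRing.Lalgebra_isAlgebra.Build K U UscaleAr.
End UqAlgebra.
End Presentation.

HB.lock Definition Upi (K : fieldType) (q : K) (q_neq0 : q != 0)
    (q2_neq1 : q ^+ 2 != 1) (u : Ufree K) : Uq_sl2 q_neq0 q2_neq1 :=
  \pi_(Uquot q) u.


Section Generators.
Variables (K : fieldType) (q : K) (q_neq0 : q != 0) (q2_neq1 : q ^+ 2 != 1).
Local Notation U := (Uq_sl2 q_neq0 q2_neq1).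
Local Notation Upi := (Upi q_neq0 q2_neq1).

Definition Ux : U := Upi (freegen K genX).
Definition Uy : U := Upi (freegen K genY).
Definition Uyinv : U := Upi (freegen K genYinv).
Definition Uz : U := Upi (freegen K genZ).

Lemma UpiD u v : Upi (u + v) = Upi u + Upi v.
Proof. by rewrite Upi.unlock; exact: pi_Uadd. Qed.

Lemma UpiN u : Upi (- u) = - Upi u.
Proof. by rewrite Upi.unlock; exact: pi_Uopp. Qed.

Lemma UpiM u v : Upi (u * v) = Upi u * Upi v.
Proof. by rewrite Upi.unlock; exact: pi_Umul. Qed.

Lemma UpiZ c u : Upi (c *: u) = c *: Upi u.
Proof. by rewrite Upi.unlock; exact: pi_Uscale. Qed.

Lemma Upi_relator u : Urelator q (u - 1) -> Upi u = 1.
Proof.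
move=> /Uideal_gen /UquotP; rewrite Upi.unlock => ->.
by rewrite -[RHS]/(Uone q) piE.
Qed.

Lemma Upi_qcomm u v : Upi (qcomm q u v) = qcomm q (Upi u) (Upi v).
Proof.
apply: etrans (UpiZ _ _) _; congr (_ *: _); apply: etrans (UpiD _ _) _.
congr (_ + _); first by apply: etrans (UpiZ _ _) _; rewrite UpiM.
by apply: etrans (UpiN _) _; congr (- _); rewrite -UpiM; apply: UpiZ.
Qed.

Lemma Uy_Uyinv : Uy * Uyinv = 1.
Proof. by rewrite -UpiM; apply: Upi_relator; do 4 left. Qed.

Lemma Uyinv_Uy : Uyinv * Uy = 1.
Proof. by rewrite -UpiM; apply: Upi_relator; do 3 left; right. Qed.

Lemma Uxy_rel : qcomm q Ux Uy = 1.
Proof. by rewrite -Upi_qcomm; apply: Upi_relator; do 2 left; right. Qed.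

Lemma Uyz_rel : qcomm q Uy Uz = 1.
Proof. by rewrite -Upi_qcomm; apply: Upi_relator; left; right. Qed.

Lemma Uzx_rel : qcomm q Uz Ux = 1.
Proof. by rewrite -Upi_qcomm; apply: Upi_relator; right. Qed.
End Generators.

(* {pred _} ranges over all subsets, since membership is classically decidable. *)
Definition linear_span (K : fieldType) (V : lmodType K) (G : set V) : set V :=
  [set v | forall S : {pred V},
     submod_closed S -> (forall g, G g -> g \in S) -> v \in S].

Definition subalg_generated (K : fieldType) (A : lalgType K) (G : set A) :
    set A :=
  [set a | forall S : {pred A},
     subalg_closed S -> (forall g, G g -> g \in S) -> a \in S].

Definition Ueven (K : fieldType) (q : K) (q_neq0 : q != 0)
    (q2_neq1 : q ^+ 2 != 1) : set (Uq_sl2 q_neq0 q2_neq1) :=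
  linear_span [set v | exists r s t : nat, ~~ odd (r + s + t) /\
    v = Ux q_neq0 q2_neq1 ^+ r * Uy q_neq0 q2_neq1 ^+ s * Uz q_neq0 q2_neq1 ^+ t].

Arguments Ueven {K q} q_neq0 q2_neq1 _.

(* Main.v *)
Require Import Defs.
From mathcomp Require Import all_boot all_order all_algebra.
From mathcomp Require Import boolp classical_sets.
From mathcomp Require Import ring.

Import GRing.Theory.
Local Open Scope classical_set_scope.
Local Open Scope ring_scope.

(** Write c = q ^ 2. The three relations say that b a = c a b + (1 - c) for
    (a, b) equal to (x, y), (y, z) and (z, x) ([qcomm_swap]).

    The even span contains the generated algebra because it is a subalgebra.
    Indeed the relations equate words of length 2 with words of length 2 and
    0, so moving a letter to its place in an ordered monomial preserves the
    parity of the length ([linear_span_straighten]). Hence left multiplication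
    by x, y or z exchanges the spans of the ordered monomials of even and of
    odd length ([parity_spanMl]), and the even span is closed under products
    ([parity_spanM]).

    Conversely, ordering b^2 a^2 gives
      b^2 a^2 = c^4 a^2 b^2 + c (1 - c) (1 + c)^2 a b + (1 - c)^2 (1 + c)
    ([qcomm_sqr_swap]). As (1 - c) (1 + c) = 1 - q^4 is nonzero, this solves
    for a b in terms of a^2 and b^2 ([subalg_qcomm_mul]), and b a follows by
    the relation ([subalg_qcomm_mulr]). So a subalgebra containing x^2, y^2
    and z^2 contains all nine products of two letters, therefore every word of
    even length ([subalg_even_word]). *)

(** * Linear spans *)

Section LinearSpan.
Variables (K : fieldType) (V : lmodType K) (G : set V).

Lemma linear_span_gen g : G g -> linear_span G g.
Proof. by move=> Gg S _; apply. Qed.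

Lemma linear_span0 : linear_span G 0.
Proof. by move=> S [S0 _] _. Qed.

Lemma linear_spanP c u v :
  linear_span G u -> linear_span G v -> linear_span G (c *: u + v).
Proof.
by move=> Gu Gv S Ssub GS; apply: Ssub.2; [apply: Gu | apply: Gv].
Qed.

(** Membership in a span quantifies over boolean predicates; this turns it into
    an induction principle for arbitrary properties, by classical
    decidability. *)
Lemma linear_span_ind (P : V -> Prop) :
    P 0 -> (forall c u v, P u -> P v -> P (c *: u + v)) ->
    (forall g, G g -> P g) ->
  forall v, linear_span G v -> P v.
Proof.
move=> P0 PD PG v /(_ [pred u | `[< P u >]]) Pv; apply/asboolP/Pv.
  split=> [|c u w /asboolP Pu /asboolP Pw]; first exact/asboolP.
  exact/asboolP/PD.
by move=> g /PG Pg; apply/asboolP.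
Qed.

End LinearSpan.

(** * Consequences of one relation *)

Section QCommutation.
Variables (K : fieldType) (q : K) (A : algType K) (a b : A).
Hypotheses (q_neq0 : q != 0) (q2_neq1 : q ^+ 2 != 1).
Hypothesis ab_rel : qcomm q a b = 1.

Lemma qcomm_swap : b * a = q ^+ 2 *: (a * b) + (1 - q ^+ 2) *: 1.
Proof.
have := congr1 ( *:%R (q - q^-1)) ab_rel.
rewrite /qcomm scalerA mulfV ?qsubV_neq0 // scale1r => /(congr1 ( *:%R q)).
rewrite scalerBr !scalerA mulfV // scale1r -expr2 mulrBr -expr2 mulfV //.
move=> /(canRL (subrK _)) ->.
by rewrite addrAC -scalerDl addrA subrK subrr scale0r add0r.
Qed.

(** The pair (z, x) is ordered against the cyclic symmetry: there it is z x, the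
    product a b, that has to be rewritten. *)
Lemma qcomm_swapV : a * b = q ^- 2 *: (b * a) + (1 - q ^- 2) *: 1.
Proof.
have q2_neq0 : q ^+ 2 != 0 by rewrite expf_neq0.
rewrite qcomm_swap scalerDr !scalerA mulVf // scale1r mulrBr mulr1 mulVf //.
by rewrite -addrA -scalerDl addrA subrK subrr scale0r addr0.
Qed.

Local Notation c := (q ^+ 2).

(** With m = a b and d = 1 - c, both a^2 b^2 and b^2 a^2 are quadratic
    polynomials in m: exchanging the two inner letters gives
    m^2 = c a^2 b^2 + d m and b^2 a^2 = c (b a)^2 + d b a, where
    b a = c m + d. Eliminating m^2 leaves a term linear in m. *)
Lemma qcomm_sqr_swap :
  b ^+ 2 * a ^+ 2 =
    c ^+ 4 *: (a ^+ 2 * b ^+ 2) + (c * (1 - c) * (1 + c) ^+ 2) *: (a * b)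
    + ((1 - c) ^+ 2 * (1 + c)) *: 1.
Proof.
have := qcomm_swap; set d := 1 - c => ba.
have abab : (a * b) * (a * b) = c *: (a ^+ 2 * b ^+ 2) + d *: (a * b).
  rewrite mulrA -(mulrA a) ba mulrDr mulrDl -scalerAr -scalerAl.
  by rewrite -scalerAr mulr1 -scalerAl !mulrA -expr2 -!mulrA -expr2 !mulrA.
have bbaa : b ^+ 2 * a ^+ 2 = c *: ((b * a) * (b * a)) + d *: (b * a).
  rewrite !expr2 mulrA -(mulrA b b a) ba.
  rewrite mulrDr mulrDl -scalerAr -scalerAl -scalerAr mulr1 -scalerAl.
  by rewrite -ba !mulrA.
rewrite bbaa ba mulrDl !mulrDr -!scalerAl -!scalerAr !mulr1 !mul1r abab.
rewrite !scalerDr !scalerA.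
move: (a ^+ 2 * b ^+ 2) (a * b) => u m.
(* Collect the coefficients of u, m and 1. *)
rewrite -addrA [X in _ + X]addrACA -!scalerDl addrA -!(addrA (_ *: u)).
rewrite -!scalerDl.
by congr (_ *: _ + (_ *: _ + _ *: _)); rewrite /d; ring.
Qed.

(** The coefficient of a b in [qcomm_sqr_swap] is q^2 (1 - q^4) (1 + q^2), which
    is invertible when q^4 is not 1, so a b is a combination of b^2 a^2,
    a^2 b^2 and 1. *)
Lemma subalg_qcomm_mul (S : {pred A}) :
    q ^+ 4 != 1 -> subalg_closed S -> a ^+ 2 \in S -> b ^+ 2 \in S ->
  a * b \in S.
Proof.
move=> q4_neq1 Ssub Sa2 Sb2; have [S1 Slin SM] := Ssub.
have [S0 _] := GRing.subalg_closedZ Ssub.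
have SZ k u : u \in S -> k *: u \in S.
  by move=> Su; rewrite -[_ *: _]addr0 Slin.
have := qcomm_sqr_swap; set e := c * _ * _.
have e_neq0 : e != 0.
  have c2E : (1 - c) * (1 + c) = 1 - q ^+ 4 by ring.
  have : (1 - c) * (1 + c) != 0 by rewrite c2E subr_eq0 eq_sym.
  rewrite mulf_eq0 negb_or => /andP[d_neq0 c1_neq0].
  by rewrite /e !mulf_neq0 ?expf_neq0.
move=> /(canLR (addrK _)) /(canLR (addKr _)) abE.
rewrite -[a * b](scalerK e_neq0) -abE SZ // -scaleNr -scaleNr Slin //.
  exact: SM.
by rewrite addrC Slin //; exact: SM.
Qed.

Lemma subalg_qcomm_mulr (S : {pred A}) :
    q ^+ 4 != 1 -> subalg_closed S -> a ^+ 2 \in S -> b ^+ 2 \in S ->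
  b * a \in S.
Proof.
move=> q4_neq1 Ssub Sa2 Sb2; have [S1 Slin _] := Ssub.
have [S0 _] := GRing.subalg_closedZ Ssub.
rewrite qcomm_swap Slin ?subalg_qcomm_mul //.
by rewrite -[_ *: _]addr0 Slin.
Qed.

End QCommutation.

Section Straightening.
Variables (K : fieldType) (A : algType K).

Lemma mul_expS_straighten (a b : A) c d n :
    b * a = c *: (a * b) + d *: 1 ->
  exists k l, b * a ^+ n.+1 = k *: (a ^+ n.+1 * b) + l *: a ^+ n.
Proof.
move=> ba; elim: n => [|n [k [l IHn]]]; first by exists c, d.
exists (k * c), (k * d + l).
rewrite exprSr mulrA IHn mulrDl -!scalerAl -exprSr -mulrA ba.
rewrite mulrDr -!scalerAr mulr1 mulrA -exprSr scalerDr !scalerA -addrA.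
by rewrite -exprSr -scalerDl.
Qed.

(** Inside a word, moving b to the right past a^n costs only one shorter word:
    the one where b and a single a have cancelled against each other. The
    two hypotheses on the span are the two words that remain; for n = 0 only
    the first occurs. *)
Lemma linear_span_straighten (G : set A) (a b u v : A) c d n :
    b * a = c *: (a * b) + d *: 1 ->
    linear_span G (u * (a ^+ n * (b * v))) ->
    (forall m, n = m.+1 -> linear_span G (u * (a ^+ m * v))) ->
  linear_span G (u * (b * (a ^+ n * v))).
Proof.
case: n => [|n] ba; first by rewrite !expr0 !mul1r.
move=> Gab /(_ n erefl) Ga.
have [k [l bE]] := mul_expS_straighten a b c d n ba.
rewrite [b * _]mulrA bE mulrDl mulrDr -!scalerAl -!scalerAr -(mulrA (a ^+ _)).
apply: linear_spanP => //; rewrite -[_ *: _]addr0.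
by apply: linear_spanP => //; apply: linear_span0.
Qed.

End Straightening.

(** * The even span *)

Section EvenSpan.
Variables (K : fieldType) (q : K) (A : algType K) (x y z : A).
Hypotheses (q_neq0 : q != 0) (q2_neq1 : q ^+ 2 != 1).
Hypotheses (xy_rel : qcomm q x y = 1) (yz_rel : qcomm q y z = 1)
           (zx_rel : qcomm q z x = 1).

Definition parity_span (e : bool) : set A :=
  linear_span [set v | exists r s t, odd (r + s + t) = e /\
                                     v = x ^+ r * y ^+ s * z ^+ t].

Lemma parity_span_monom e r s t :
  odd (r + s + t) = e -> parity_span e (x ^+ r * (y ^+ s * z ^+ t)).
Proof.
by move=> rst; rewrite mulrA; apply: linear_span_gen; exists r, s, t.
Qed.

(** Either the new letter g reaches its place, which adds 1 to the length, or it
    cancels one letter on its way, which subtracts 1: y moves past the powers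
    of x, and z past those of x and then of y. *)
Lemma parity_spanMl g e v :
  g \in [:: x; y; z] -> parity_span e v -> parity_span (~~ e) (g * v).
Proof.
move=> g_in; move: v.
apply: linear_span_ind => [|c u v Eu Ev|_ [r [s [t [<- ->]]]]].
- by rewrite mulr0; apply: linear_span0.
- by rewrite mulrDr -scalerAr; apply: linear_spanP.
rewrite -mulrA; move: g_in; rewrite !inE => /or3P[] /eqP->.
- by rewrite mulrA -exprS; apply: parity_span_monom.
- rewrite -[_ * _]mul1r.
  apply: linear_span_straighten
    (qcomm_swap _ _ _ _ _ q_neq0 q2_neq1 xy_rel) _ _.
    rewrite mul1r [y * _]mulrA -exprS; apply: parity_span_monom.
    by rewrite addnS addSn.
  move=> m ->; rewrite mul1r; apply: parity_span_monom.
  by rewrite !addSn /= negbK.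
- rewrite -[_ * _]mul1r.
  apply: linear_span_straighten
    (qcomm_swapV _ _ _ _ _ q_neq0 q2_neq1 zx_rel) _ _.
    rewrite mul1r.
    apply: linear_span_straighten
      (qcomm_swap _ _ _ _ _ q_neq0 q2_neq1 yz_rel) _ _.
      by rewrite -exprS; apply: parity_span_monom; rewrite addnS.
    move=> m ->; apply: parity_span_monom.
    by rewrite addnS addSn /= negbK.
  move=> m ->; rewrite mul1r; apply: parity_span_monom.
  by rewrite !addSn /= negbK.
Qed.

Lemma parity_spanMexpl g n e v :
    g \in [:: x; y; z] -> parity_span e v ->
  parity_span (odd n (+) e) (g ^+ n * v).
Proof.
move=> g_in Ev; elim: n => [|n IHn]; first by rewrite expr0 mul1r.
by rewrite exprS -mulrA /= addNb; apply: parity_spanMl.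
Qed.

Lemma parity_spanM e f u v :
  parity_span e u -> parity_span f v -> parity_span (e (+) f) (u * v).
Proof.
move=> + Fv; move: u.
apply: linear_span_ind => [|c u w Eu Ew|_ [r [s [t [<- ->]]]]].
- by rewrite mul0r; apply: linear_span0.
- by rewrite mulrDl -scalerAl; apply: linear_spanP.
rewrite -!mulrA !oddD -!addbA.
by do 3!(apply: parity_spanMexpl; first by rewrite !inE eqxx ?orbT).
Qed.

(** Cut the word into consecutive pairs of letters. *)
Lemma subalg_even_word (S T : {pred A}) (w : seq A) :
    subalg_closed S -> {in T &, forall g h, g * h \in S} ->
    {subset w <= T} -> ~~ odd (size w) ->
  \prod_(g <- w) g \in S.
Proof.
move=> [S1 _ SM] TS.
have [n] := ubnP (size w); elim: n w => // n IHn [|g [|h w]] //=.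
  by rewrite big_nil.
rewrite ltnS => ltwn wT; rewrite negbK => w_even.
rewrite !big_cons mulrA SM //.
  by rewrite TS ?wT ?inE ?eqxx ?orbT.
apply: IHn => //; first exact: ltnW.
by move=> k kw; rewrite wT // !inE kw !orbT.
Qed.

Theorem subalg_generated_sqr (q4_neq1 : q ^+ 4 != 1) :
  subalg_generated [set x ^+ 2; y ^+ 2; z ^+ 2] = parity_span false.
Proof.
apply/seteqP; split=> v.
- move=> /(_ [pred u | `[< parity_span false u >]]) genv.
  apply/asboolP/genv; first split.
  + apply/asboolP; rewrite -[1]mulr1 -[1 * 1]mulr1.
    by apply: linear_span_gen; exists 0, 0, 0.
  + move=> c u w /asboolP Eu /asboolP Ew.
    by apply/asboolP; apply: linear_spanP.
  + move=> u w /asboolP Eu /asboolP Ew.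
    by apply/asboolP; apply: (parity_spanM false false).
  have spanE r s t : odd (r + s + t) = false ->
      x ^+ r * y ^+ s * z ^+ t \in [pred u | `[< parity_span false u >]].
    by move=> rst; apply/asboolP; rewrite -mulrA; apply: parity_span_monom.
  move=> g [[]|] ->.
  + by have := spanE 2 0 0 erefl; rewrite !mulr1.
  + by have := spanE 0 2 0 erefl; rewrite mulr1 mul1r.
  + by have := spanE 0 0 2 erefl; rewrite !mul1r.
- move=> spanv S Ssub genS; apply: spanv; first exact: GRing.subalg_closedZ.
  move=> _ [r [s [t [rst ->]]]].
  have [Sx Sy Sz] : [/\ x ^+ 2 \in S, y ^+ 2 \in S & z ^+ 2 \in S].
    by split; apply: genS; [left; left | left; right | right].
  have -> : x ^+ r * y ^+ s * z ^+ t =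
      \prod_(g <- nseq r x ++ nseq s y ++ nseq t z) g.
    by rewrite !big_cat /= !big_nseq !iter_mulr_1 mulrA.
  apply: (subalg_even_word S (mem [:: x; y; z])) => //.
  + move=> g h; rewrite !inE => /or3P[] /eqP-> /or3P[] /eqP->;
    rewrite -?expr2 //;
    first [by apply: (subalg_qcomm_mul K q)
          |by apply: (subalg_qcomm_mulr K q)].
  + move=> g; rewrite !mem_cat !mem_nseq !inE.
    by case/or3P=> /andP[_ ->]; rewrite ?orbT.
  + by rewrite !size_cat !size_nseq addnA rst.
Qed.

End EvenSpan.

Theorem corollary4p4 (K : fieldType) (q : K)
    (q_neq0 : q != 0) (q2_neq1 : q ^+ 2 != 1) (q4_neq1 : q ^+ 4 != 1) :
  subalg_generated [set Ux q_neq0 q2_neq1 ^+ 2;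
                        Uy q_neq0 q2_neq1 ^+ 2;
                        Uz q_neq0 q2_neq1 ^+ 2]
  = Ueven q_neq0 q2_neq1.
Proof.
rewrite (subalg_generated_sqr K q) //; first last.
- exact: Uzx_rel.
- exact: Uyz_rel.
- exact: Uxy_rel.
congr linear_span; apply/seteqP; split=> v [r [s [t [rst ->]]]].
  by exists r, s, t; rewrite rst.
by exists r, s, t; rewrite (negbTE rst).
Qed.
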